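(* Let $n\ge 0$. The set of proper noncrossing trees with $n$ edges is in bijection with the set $\mathcal{S}_n$ of symmetric ternary trees with $n$ internal vertices. In particular, the number $t_n$ of proper noncrossing trees with $n$ edges equals the number $s_n=|\mathcal{S}_n|$.
   Context: A noncrossing tree with $n$ edges is a tree on the vertex set $\{1,\dots,n+1\}$, the vertices placed in counterclockwise order on a circle, with edges drawn as chords inside the circle that pairwise do not cross. It is rooted at vertex $1$. A descent is an edge $(i,j)$ with $i>j$ such that $i$ is the parent of $j$, i.e. $i$ lies on the path from the root $1$ to $j$. Equivalently, a noncrossing tree is represented as a rooted plane tree in which each non-root vertex $j$ with parent $i$ is labeled $L$ if $i>j$ and $R$ if $i<j$; the root is unlabeled and all children of the root are labeled $R$. In this representation a child labeled $L$ is a ''left child'', a child labeled $R$ is a ''right child'', and descents correspond exactly to $L$-labeled vertices. A noncrossing tree is even if its number of descents is even, odd otherwise. If the tree is even, a non-root vertex $v$ is proper if it has an even number of left children and no right child; if the tree is odd, a non-root vertex $v$ is proper if it has an even number of right children and no left child. A noncrossing tree is proper if every non-root vertex is proper. A ternary tree is either a single node or a root with an ordered triple (left, middle, right) of ternary trees; internal vertices are those with children. A symmetric ternary tree is a ternary tree whose root's middle subtree is a symmetric ternary tree and whose right subtree is the mirror reflection of its left subtree (the single node is symmetric). *)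

(* Defs.v *)
From HB Require Import structures.
From mathcomp Require Import all_boot.

Set Implicit Arguments.
Unset Strict Implicit.
Unset Printing Implicit Defensive.

(* The vertices 1, ..., n+1 are represented by 0, ..., n, i.e. by 'I_n.+1,
   whose order is the cyclic order of the points on the circle; the root is
   ord0. A graph is given by its set of edges. *)

Section NoncrossingTrees.

Variable n : nat.
Notation vertex := 'I_n.+1.
Implicit Types (E : {set {set vertex}}) (u v i j : vertex).

Definition is_graph E := [forall e in E, #|e| == 2].

Definition adj E : rel vertex := [rel u v | (u != v) && ([set u; v] \in E)].

Definition connected E := [forall u, forall v, connect (adj E) u v].

(* A sequence without repetition has at most n.+1 entries, so that bounding
   the length of the cycle loses nothing: see acyclicP. *)
Definition acyclic E :=
  [forall k : 'I_n.+2, forall c : k.-tuple vertex,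
     (2 < k) ==> ~~ ucycleb (adj E) c].

Definition is_tree E := [&& is_graph E, connected E & acyclic E].

(* Two chords cross iff their endpoints are distinct and alternate around the
   circle. *)
Definition noncrossing E :=
  [forall a : vertex, forall b : vertex, forall c : vertex, forall d : vertex,
     [&& a < b, b < c & c < d] ==> ~~ (adj E a c && adj E b d)].

Definition noncrossing_tree E := is_tree E && noncrossing E.

Definition simple_path_to E j (p : seq vertex) :=
  [&& path (adj E) ord0 p, uniq (ord0 :: p) & last ord0 p == j].

(* The length bound on the path is harmless: see on_root_pathP. *)
Definition on_root_path E i j :=
  [exists k : 'I_n.+1, exists p : k.-tuple vertex,
     simple_path_to E j p && (i \in ord0 :: p)].

Definition parent E i j := adj E i j && on_root_path E i j.

Definition descents E :=
  [set ij : vertex * vertex | (ij.2 < ij.1) && parent E ij.1 ij.2].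

Definition left_children E i := [set j | parent E i j && (j < i)].

Definition right_children E i := [set j | parent E i j && (i < j)].

Definition odd_tree E := odd #|descents E|.

Definition proper_vertex E v :=
  if odd_tree E then ~~ odd #|right_children E v| && (left_children E v == set0)
  else ~~ odd #|left_children E v| && (right_children E v == set0).

Definition proper_noncrossing_tree E :=
  noncrossing_tree E && [forall v, (v != ord0) ==> proper_vertex E v].

Lemma acyclicP E :
  reflect (forall c : seq vertex, 2 < size c -> ~ ucycle (adj E) c)
          (acyclic E).
Proof.
apply: (iffP 'forall_'forall_implyP) => acE.
  move=> c c_gt2 cycE; have /andP[_ Uc] := cycE.
  have szc : size c < n.+2.
    by have := max_card (mem c); rewrite (card_uniqP Uc) card_ord.
  by have /negP[] := acE (Ordinal szc) (in_tuple c) c_gt2.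
by move=> k c k_gt2; apply/negP/acE; rewrite size_tuple.
Qed.

Lemma on_root_pathP E i j :
  reflect (exists2 p : seq vertex, simple_path_to E j p & i \in ord0 :: p)
          (on_root_path E i j).
Proof.
apply: (iffP 'exists_'exists_andP) => [[k [p [Ep ip]]]|[p Ep ip]].
  by exists p.
have /and3P[_ Up _] := Ep.
have szp : size p < n.+1.
  by have := max_card (mem (ord0 :: p)); rewrite (card_uniqP Up) card_ord.
by exists (Ordinal szp), (in_tuple p).
Qed.

End NoncrossingTrees.

Definition proper_nct (n : nat) :=
  {E : {set {set 'I_n.+1}} | proper_noncrossing_tree E}.

HB.instance Definition _ n := SubFinite.on (proper_nct n).

Inductive ternary : Type :=
| TLeaf
| TNode of ternary & ternary & ternary.

Fixpoint internal (t : ternary) : nat :=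
  if t is TNode l m r then (internal l + internal m + internal r).+1 else 0.

Fixpoint mirror (t : ternary) : ternary :=
  if t is TNode l m r then TNode (mirror r) (mirror m) (mirror l) else TLeaf.

Fixpoint ternary_code (t : ternary) : GenTree.tree unit :=
  if t is TNode l m r
  then GenTree.Node 1 [:: ternary_code l; ternary_code m; ternary_code r]
  else GenTree.Node 0 [::].

Fixpoint ternary_decode (c : GenTree.tree unit) : ternary :=
  if c is GenTree.Node 1 [:: l; m; r]
  then TNode (ternary_decode l) (ternary_decode m) (ternary_decode r)
  else TLeaf.

Lemma ternary_codeK : cancel ternary_code ternary_decode.
Proof. by elim=> //= l -> m -> r ->. Qed.

HB.instance Definition _ := Countable.copy ternary (can_type ternary_codeK).

Fixpoint symmetric_ternary (t : ternary) : bool :=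
  if t is TNode l m r then symmetric_ternary m && (r == mirror l) else true.

Record sym_ternary (n : nat) := SymTernary {
  sym_ternary_tree :> ternary;
  _ : symmetric_ternary sym_ternary_tree && (internal sym_ternary_tree == n)
}.

HB.instance Definition _ n := [isSub for @sym_ternary_tree n].
HB.instance Definition _ n := [Countable of sym_ternary n by <:].

(* All ternary trees of height at most h, possibly with repetitions. *)
Fixpoint ternary_upto (h : nat) : seq ternary :=
  if h is h'.+1 then
    let s := ternary_upto h' in
    TLeaf :: [seq TNode x.1 x.2.1 x.2.2
             | x <- [seq (l, y) | l <- s, y <- [seq (m, r) | m <- s, r <- s]]]
  else [:: TLeaf].

Lemma mem_ternary_upto h t : internal t <= h -> t \in ternary_upto h.
Proof.
elim: h t => [|h IHh] [|l m r] //=; rewrite ltnS => le_h.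
rewrite inE /=; apply/mapP; exists (l, (m, r)) => //.
apply/allpairsP; exists (l, (m, r)); split=> //=.
  by apply/IHh/(leq_trans _ le_h); rewrite -addnA leq_addr.
apply/allpairsP; exists (m, r); split=> //=; apply/IHh/(leq_trans _ le_h).
  by rewrite addnAC leq_addl.
by rewrite leq_addl.
Qed.

Definition sym_ternary_enum n : seq (sym_ternary n) :=
  undup (pmap insub (ternary_upto n)).

Lemma sym_ternary_enumP n : Finite.axiom (sym_ternary_enum n).
Proof.
apply: Finite.uniq_enumP => [|t]; first exact: undup_uniq.
rewrite mem_undup mem_pmap_sub inE; apply: mem_ternary_upto.
by case/andP: (valP t) => _ /eqP->.
Qed.

HB.instance Definition _ n :=
  isFinite.Build (sym_ternary n) (@sym_ternary_enumP n).

(* Main.v *)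
Require Import Defs.
From mathcomp Require Import all_boot zmodp zify.

(* A proper tree is even, since an odd one would have no left child, hence no
   descent; so each non-root vertex has only smaller children, an even number of
   them. Once the root is moved to the last place, every parent is larger than
   its children and the absence of crossings means that the vertices are
   numbered in postorder. Deleting the root leaves an arbitrary plane forest
   whose vertices all have even degree. If it has an even number of trees, it is
   empty or consists of two trees followed by a shorter such forest, each tree
   being given by the forest below its root: this is the recursion of ternary
   trees, with two vertices per internal vertex. In general it is empty or
   consists of a tree followed by a forest: this is the recursion of symmetric
   ternary trees, the left subtree encoding the first tree and the middle
   subtree the rest. *)

Set Implicit Arguments.
Unset Strict Implicit.
Unset Printing Implicit Defensive.

(** * Even forests and ternary trees *)

(* [FCons H G] is the forest [G] preceded by a tree whose root has [H] as the
   forest of its subtrees. *)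
Inductive forest : Type :=
| FNil
| FCons of forest & forest.

Fixpoint fsize (F : forest) : nat :=
  if F is FCons H G then fsize H + (fsize G).+1 else 0.

Fixpoint nb_trees (F : forest) : nat :=
  if F is FCons _ G then (nb_trees G).+1 else 0.

Fixpoint even_forest (F : forest) : bool :=
  if F is FCons H G
  then [&& even_forest H, ~~ odd (nb_trees H) & even_forest G]
  else true.

Fixpoint forest_of_ternary (t : ternary) : forest :=
  if t is TNode l m r
  then FCons (forest_of_ternary l)
             (FCons (forest_of_ternary m) (forest_of_ternary r))
  else FNil.

Fixpoint ternary_of_forest (F : forest) : ternary :=
  if F is FCons H1 (FCons H2 G)
  then TNode (ternary_of_forest H1) (ternary_of_forest H2) (ternary_of_forest G)
  else TLeaf.

Lemma forest_of_ternaryK : cancel forest_of_ternary ternary_of_forest.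
Proof. by elim=> //= l -> m -> r ->. Qed.

Lemma ternary_of_forestK F :
  even_forest F -> ~~ odd (nb_trees F) ->
  forest_of_ternary (ternary_of_forest F) = F.
Proof.
have [k] := ubnP (fsize F); elim: k F => // k IHk [|H1 [|H2 G]] //= szF.
case/and3P=> ev1 odd1 /and3P[ev2 odd2 evG]; rewrite negbK => oddG.
by rewrite !IHk //; lia.
Qed.

Lemma fsize_forest_of_ternary t :
  fsize (forest_of_ternary t) = (internal t).*2.
Proof. by elim: t => //= l -> m -> r ->; lia. Qed.

Lemma odd_nb_trees_forest_of_ternary t :
  odd (nb_trees (forest_of_ternary t)) = false.
Proof. by elim: t => //= l _ m _ r ->. Qed.

Lemma even_forest_of_ternary t : even_forest (forest_of_ternary t).
Proof.
by elim: t => //= l -> m -> r ->; rewrite !odd_nb_trees_forest_of_ternary.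
Qed.

Lemma internal_mirror t : internal (mirror t) = internal t.
Proof. by elim: t => //= l -> m -> r ->; lia. Qed.

Fixpoint forest_of_sym (t : ternary) : forest :=
  if t is TNode l m _ then FCons (forest_of_ternary l) (forest_of_sym m)
  else FNil.

Fixpoint sym_of_forest (F : forest) : ternary :=
  if F is FCons H G then
    let l := ternary_of_forest H in TNode l (sym_of_forest G) (mirror l)
  else TLeaf.

Lemma symmetric_sym_of_forest F : symmetric_ternary (sym_of_forest F).
Proof. by elim: F => //= H _ G ->; rewrite eqxx. Qed.

Lemma forest_of_symK :
  {in symmetric_ternary, cancel forest_of_sym sym_of_forest}.
Proof.
elim=> //= l _ m IHm r _ /andP[sym_m /eqP->].
by rewrite forest_of_ternaryK IHm.
Qed.

Lemma sym_of_forestK : {in even_forest, cancel sym_of_forest forest_of_sym}.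
Proof.
elim=> //= H _ G IHG /and3P[evH oddH evG].
by rewrite ternary_of_forestK ?IHG.
Qed.

Lemma fsize_forest_of_sym t :
  symmetric_ternary t -> fsize (forest_of_sym t) = internal t.
Proof.
elim: t => //= l _ m IHm r _ /andP[/IHm-> /eqP->].
by rewrite fsize_forest_of_ternary internal_mirror; lia.
Qed.

Lemma even_forest_of_sym t : even_forest (forest_of_sym t).
Proof.
elim: t => //= l _ m -> r _.
by rewrite even_forest_of_ternary odd_nb_trees_forest_of_ternary.
Qed.

(** * Postorder numberings of forests *)

(* The parents of the vertices of [F] in postorder, when these are numbered from
   [a] and [r] stands for the parent of the roots of [F]. *)
Fixpoint parents (F : forest) (a r : nat) : seq nat :=
  if F is FCons H G then
    let v := a + fsize H in parents H a v ++ r :: parents G v.+1 r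
  else [::].

Lemma size_parents F a r : size (parents F a r) = fsize F.
Proof.
by elim: F a r => //= H IHH G IHG a r; rewrite size_cat /= IHH IHG.
Qed.

Lemma mem_parents F a r w :
  w \in parents F a r -> w = r \/ a <= w < a + fsize F.
Proof.
elim: F a r => //= H IHH G IHG a r; rewrite mem_cat inE.
by case/or3P=> [/IHH|/eqP->|/IHG]; lia.
Qed.

Lemma count_parents_eq0 F a r w :
  w <> r -> ~~ (a <= w < a + fsize F) -> count_mem w (parents F a r) = 0.
Proof. by move=> neq_wr out_w; apply/count_memPn/negP => /mem_parents; lia. Qed.

Lemma count_parents_root F a r :
  a + fsize F <= r -> count_mem r (parents F a r) = nb_trees F.
Proof.
elim: F a r => //= H _ G IHG a r le_r.
by rewrite count_cat /= eqxx IHG ?count_parents_eq0; lia.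
Qed.

Lemma even_forestE F a r :
  a + fsize F <= r ->
  even_forest F =
    all (fun w => ~~ odd (count_mem w (parents F a r))) (iota a (fsize F)).
Proof.
elim: F a r => //= H IHH G IHG a r le_r; set v := a + fsize H.
rewrite iotaD all_cat /= -/v.
rewrite (IHH a v) // (IHG v.+1 r); last by lia.
congr [&& _, _ & _].
- apply: eq_in_all => w; rewrite mem_iota => w_in.
  by rewrite count_cat /= (@count_parents_eq0 G); lia.
- by rewrite count_cat /= count_parents_root // count_parents_eq0; lia.
apply: eq_in_all => w; rewrite mem_iota => w_in.
by rewrite count_cat /= (@count_parents_eq0 H); lia.
Qed.

Lemma parents_inj F F' a r :
  a + fsize F <= r -> parents F a r = parents F' a r -> F = F'.
Proof.
elim: F F' a r => [|H IHH G IHG] [|H' G'] a r //= le_r eqF.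
- by move/(congr1 size): eqF; rewrite size_cat addnS.
- by move/(congr1 size): eqF; rewrite size_cat addnS.
have index_root F1 s : a + fsize F1 < r ->
    index r (parents F1 a (a + fsize F1) ++ r :: s) = fsize F1.
  move=> lt_r; rewrite index_cat ifN; last by apply/negP => /mem_parents; lia.
  by rewrite size_parents /= eqxx addn0.
have eq_size : fsize H + (fsize G).+1 = fsize H' + (fsize G').+1.
  by have := congr1 size eqF; rewrite !size_cat /= !size_parents; lia.
have eqH : fsize H = fsize H'.
  by have := congr1 (index r) eqF; rewrite !index_root; lia.
move/eqP: eqF; rewrite -eqH eqseq_cat ?size_parents // eqseq_cons eqxx /=.
case/andP=> /eqP/IHH-> // /eqP/IHG-> //; lia.
Qed.

Definition forest_parent (F : forest) (a r i : nat) : nat :=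
  nth r (parents F a r) (i - a).

Lemma forest_parent_cons H G a r i (v := a + fsize H) :
  a <= i ->
  forest_parent (FCons H G) a r i =
    if i < v then forest_parent H a v i
    else if i == v then r else forest_parent G v.+1 r i.
Proof.
rewrite /forest_parent /= nth_cat size_parents -/v => ai.
have -> : (i - a < fsize H) = (i < v) by lia.
case: ltnP => [iv|vi].
  by apply: set_nth_default; rewrite size_parents; lia.
have -> : i - a - fsize H = i - v by lia.
have [->|neq_iv] := eqVneq i v; first by rewrite subnn.
by have -> : i - v = (i - v.+1).+1 by lia.
Qed.

Lemma map_forest_parent F a r :
  [seq forest_parent F a r i | i <- index_iota a (a + fsize F)] = parents F a r.
Proof.
rewrite /index_iota addKn -(addn0 a) iotaDl addn0 -map_comp.
rewrite -[RHS](mkseq_nth r) size_parents.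
by apply: eq_map => i; rewrite /= /forest_parent addKn.
Qed.

(* [Q] maps each vertex of a forest to its parent, where the vertices are
   numbered [a, ..., b - 1] in postorder and [r] stands for the parent of the
   roots. *)
Record postorder a b r (Q : nat -> nat) : Prop := Postorder {
  postorder_gt : forall i, a <= i < b -> i < Q i;
  postorder_bound : forall i, a <= i < b -> Q i < b \/ Q i = r;
  postorder_nested : forall i j, a <= i -> i < j < b -> j < Q i -> Q j <= Q i
}.

Lemma postorder_forest_parent F a r :
  a + fsize F <= r -> postorder a (a + fsize F) r (forest_parent F a r).
Proof.
elim: F a r => [|H IHH G IHG] a r le_r; first by split => /=; lia.
rewrite /= in le_r; set v := a + fsize H.
have [gtH boundH nestH] : postorder a v v (forest_parent H a v) by exact: IHH.
have [|gtG boundG nestG] := IHG v.+1 r; first by lia.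
have -> : a + fsize (FCons H G) = v.+1 + fsize G by rewrite /=; lia.
split=> [i i_in|i i_in|i j ai ij]; rewrite !forest_parent_cons -/v; try lia.
- case: (ltnP i v) => iv; first by apply: gtH; lia.
  by case: eqVneq => iv'; [lia | apply: gtG; lia].
- case: (ltnP i v) => iv; first by have := boundH i; lia.
  by case: eqVneq => iv'; [lia | apply: boundG; lia].
have [iv|vi] := ltnP i v.
  have := boundH i; have := nestH i j.
  by case: (ltnP j v) => jv; [lia | case: (eqVneq j v); lia].
have [|_] := ltnP j v; first by lia.
have -> : (j == v) = false by lia.
have [_|neq_iv] := eqVneq i v; first by have := boundG j; lia.
by have := nestG i j; lia.
Qed.

Lemma postorder_forest a b r Q :
  a <= b <= r -> postorder a b r Q ->
  exists F, parents F a r = [seq Q i | i <- index_iota a b].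
Proof.
have [k] := ubnP (b - a); elim: k a b r Q => // k IHk a b r Q lt_k.
case/andP; rewrite leq_eqVlt => /predU1P[-> _ _|ab br [gtQ boundQ nestQ]].
  by exists FNil; rewrite /index_iota subnn.
have root_exists : exists v, (a <= v < b) && (Q v == r).
  by exists b.-1; have := gtQ b.-1; have := boundQ b.-1; lia.
have [v /andP[/andP[av vb] /eqP Qv] min_v] := ex_minnP root_exists.
have [|||H parH] := IHk a v v Q; try lia.
  split=> [i|i i_in|i j]; [have := gtQ i; lia | | have := nestQ i j; lia].
  by have := boundQ i; have := nestQ i v; have := min_v i; lia.
have [|||G parG] := IHk v.+1 b r Q; try lia.
  by split=> [i|i|i j]; [have := gtQ i | have := boundQ i | have := nestQ i j];
    lia.
have eq_v : a + fsize H = v.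
  by have := congr1 size parH; rewrite size_parents size_map size_iota; lia.
exists (FCons H G); rewrite /= eq_v parH parG.
rewrite /index_iota (_ : b - a = (v - a) + (b - v.+1).+1) ?iotaD ?map_cat /=.
  by rewrite subnKC // Qv.
by lia.
Qed.

(** * Rooted trees and parent functions *)

Section RootedTrees.

Variable n : nat.
Implicit Types (E : {set {set 'I_n.+1}}) (u v i j : 'I_n.+1).

Lemma adj_sym E : symmetric (adj E).
Proof. by move=> u v; rewrite /adj /= eq_sym setUC. Qed.

Lemma parent_neq_root E i j : parent E i j -> j != ord0.
Proof.
case/andP=> /andP[neq_ij _] /on_root_pathP[p /and3P[_ Up /eqP lastp] ip].
apply: contraNneq neq_ij => j0; move: Up lastp ip; rewrite j0.
case: p => [|x p] /=; first by rewrite inE.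
by case/andP=> + _ last0; rewrite -{1}last0 mem_last.
Qed.

Definition adj_avoiding E j := [rel x y | [&& adj E x y, x != j & y != j]].

Lemma connect_avoiding_sym E j : connect_sym (adj_avoiding E j).
Proof.
by apply: sym_connect_sym => x y; rewrite /= adj_sym [(x != j) && _]andbC.
Qed.

Lemma parent_connect_avoiding E i j :
  parent E i j -> connect (adj_avoiding E j) ord0 i.
Proof.
case/andP=> /andP[neq_ij _] /on_root_pathP[p /and3P[Ep Up /eqP lastp] ip].
case/splitPl: ip => p1 p2 last_p1 in Ep Up lastp *.
have j_p2 : j \in p2.
  move: lastp; rewrite last_cat last_p1.
  case: p2 {Ep Up} => [/eqP|y p2 <-] /=; first by rewrite (negPf neq_ij).
  exact: mem_last.
apply/connectP; exists p1 => //; move: Ep Up.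
rewrite cat_path -cat_cons cat_uniq => /andP[Ep1 _] /and3P[_ /hasPn no_p1 _].
apply: (@sub_in_path _ (predC1 j) (adj E)) Ep1 => [x y xj yj /= ->|].
  by rewrite [x != j]xj.
by apply/allP => x xp1; apply: contraTneq xp1 => ->; apply: no_p1.
Qed.

(* A path from [i] to [i'] avoiding [j] would close to a cycle through [j]. *)
Lemma acyclic_neighbours_eq E i i' j :
    acyclic E -> adj E j i -> adj E j i' ->
  connect (adj_avoiding E j) i i' -> i = i'.
Proof.
move=> /acyclicP acE Eji Eji' /connectP[p Ep eq_i'].
case/shortenP: Ep eq_i' => {p} [[//|y p]] Ep Up _ eq_i'.
have jp : j \notin i :: y :: p.
  have no_j q x : path (adj_avoiding E j) x q -> j \notin q.
    elim: q x => //= z q IHq x /andP[/and3P[_ _ zj] /IHq jq].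
    by rewrite inE negb_or eq_sym zj.
  by rewrite inE negb_or (no_j _ _ Ep) andbT; case/andP: Eji.
have Eyp : path (adj E) i (y :: p) by apply: sub_path Ep => u v /and3P[].
case: (acE [:: j, i, y & p]) => //; rewrite /ucycle cons_uniq jp Up.
by rewrite (cycle_path j) (_ : last j _ = i') //= adj_sym Eji' Eji andbT.
Qed.

Lemma parent_uniq E i i' j :
  acyclic E -> parent E i j -> parent E i' j -> i = i'.
Proof.
move=> acE pi pi'; apply: (@acyclic_neighbours_eq E i i' j) => //.
- by case/andP: pi; rewrite adj_sym.
- by case/andP: pi'; rewrite adj_sym.
apply: connect_trans (parent_connect_avoiding pi').
by rewrite connect_avoiding_sym parent_connect_avoiding.
Qed.

Lemma connected_root_path E j : connected E -> exists p, simple_path_to E j p.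
Proof.
move=> /'forall_forallP/(_ ord0 j)/connectP[p Ep ->].
by case/shortenP: Ep => q Eq Uq _; exists q; rewrite /simple_path_to Eq Uq eqxx.
Qed.

Lemma adj_parent E u v :
  connected E -> adj E u v -> parent E u v || parent E v u.
Proof.
move=> conE Euv; rewrite /parent Euv adj_sym Euv /=.
have [p Ep] := connected_root_path u conE.
have [vp|vp] := boolP (v \in ord0 :: p).
  by apply/orP; right; apply/on_root_pathP; exists p.
case/and3P: Ep => Ep Up /eqP lastp.
apply/orP; left; apply/on_root_pathP; exists (rcons p v).
  by rewrite /simple_path_to rcons_path -rcons_cons rcons_uniq last_rcons
    Ep Up vp lastp Euv eqxx.
by rewrite -rcons_cons mem_rcons inE -lastp mem_last orbT.
Qed.

Lemma parent_exists E j : connected E -> j != ord0 -> exists i, parent E i j.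
Proof.
move=> conE j0; have [p Ep] := connected_root_path j conE.
case/lastP: p => [|p k] in Ep *.
  by case/and3P: Ep => _ _ /eqP eq_j; rewrite -eq_j eqxx in j0.
have eq_k : k = j by case/and3P: Ep => _ _; rewrite last_rcons => /eqP.
exists (last ord0 p); apply/andP; split.
  by case/and3P: Ep; rewrite rcons_path -eq_k => /andP[].
apply/on_root_pathP; exists (rcons p k) => //.
by rewrite -rcons_cons mem_rcons inE mem_last orbT.
Qed.

Definition parent_graph (f : 'I_n.+1 -> 'I_n.+1) : {set {set 'I_n.+1}} :=
  [set [set j; f j] | j : 'I_n.+1 & j != ord0].

Lemma eq_parent_graph f g :
  (forall j, j != ord0 -> f j = g j) -> parent_graph f = parent_graph g.
Proof. by move=> eq_fg; apply: eq_in_imset => j; rewrite inE => /eq_fg->. Qed.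

Lemma tree_parent_graph E : is_tree E ->
  exists2 f, parent_graph f = E & forall j, j != ord0 -> parent E (f j) j.
Proof.
case/and3P=> graphE conE acE.
pose f j := odflt ord0 [pick i | parent E i j].
have parent_f j : j != ord0 -> parent E (f j) j.
  move=> j0; rewrite /f; case: pickP => //= no_parent.
  by have [i] := parent_exists conE j0; rewrite no_parent.
exists f => //; apply/setP => e; apply/imsetP/idP => [[j]|eE].
  by rewrite inE => /parent_f/andP[/andP[_ +] _] ->; rewrite setUC.
have edge_parent u v : parent E u v -> [set u; v] = [set v; f v].
  move=> p_uv; rewrite setUC (@parent_uniq E u (f v) v) //.
  exact/parent_f/(parent_neq_root p_uv).
have /'forall_implyP/(_ e eE)/cards2P[u [v [neq_uv eq_e]]] := graphE.
have /(adj_parent conE)/orP[] : adj E u v by rewrite /adj /= neq_uv -eq_e.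
  move=> p_uv; exists v; last by rewrite eq_e (edge_parent u).
  by rewrite inE (parent_neq_root p_uv).
move=> p_vu; exists u; last by rewrite eq_e setUC (edge_parent v).
by rewrite inE (parent_neq_root p_vu).
Qed.

Section ParentGraph.

Variables (f : 'I_n.+1 -> 'I_n.+1) (depth : 'I_n.+1 -> nat).
Hypothesis depth_f : forall j, j != ord0 -> depth (f j) < depth j.
Notation E := (parent_graph f).

Definition is_child u j : bool := (j != ord0) && (u == f j).

Lemma is_child_depth u j : is_child u j -> depth u < depth j.
Proof. by case/andP=> j0 /eqP->; apply: depth_f. Qed.

Lemma adj_parent_graph u v : adj E u v = is_child u v || is_child v u.
Proof.
apply/andP/orP => [[neq_uv /imsetP[j]]|].
  rewrite inE => j0 eq_uv; move: neq_uv.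
  have /set2P[->|->] : u \in [set j; f j] by rewrite -eq_uv set21.
    have /set2P[->|->] : v \in [set j; f j] by rewrite -eq_uv set22.
      by rewrite eqxx.
    by right; rewrite /is_child j0 eqxx.
  have /set2P[->|->] : v \in [set j; f j] by rewrite -eq_uv set22.
    by left; rewrite /is_child j0 eqxx.
  by rewrite eqxx.
have child_edge i j : is_child i j -> i != j /\ [set i; j] \in E.
  move=> c; have lt_d := is_child_depth c; case/andP: c => j0 /eqP eq_i.
  split; first by apply: contraTneq lt_d => ->; rewrite ltnn.
  by apply/imsetP; exists j; rewrite ?inE // eq_i setUC.
by case=> /child_edge[] //; rewrite eq_sym setUC.
Qed.

Lemma child_path_last x p y :
  path is_child x p -> y \in x :: p -> depth y <= depth (last x p).
Proof.
elim: p x y => [|z p IHp] x y /=; first by rewrite inE => _ /eqP->.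
case/andP=> /is_child_depth lt_xz cp; rewrite inE.
case/predU1P=> [->|]; last exact: IHp.
by apply/ltnW/(leq_trans lt_xz)/IHp; rewrite ?mem_head.
Qed.

Lemma child_path_exists j :
  exists2 p, simple_path_to E j p & path is_child ord0 p.
Proof.
have [k] := ubnP (depth j); elim: k j => // k IHk j lt_k.
have [->|j0] := eqVneq j ord0.
  by exists [::]; rewrite /simple_path_to //= eqxx.
have [p /and3P[Ep Up /eqP lastp] cp] := IHk (f j) (leq_trans (depth_f j0) lt_k).
have cj : is_child (f j) j by rewrite /is_child j0 eqxx.
exists (rcons p j); last by rewrite rcons_path cp lastp.
apply/and3P; split; last by rewrite last_rcons.
  by rewrite rcons_path Ep lastp adj_parent_graph cj.
rewrite -rcons_cons rcons_uniq Up andbT; apply/negP => jp.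
by have := child_path_last cp jp; rewrite lastp leqNgt depth_f.
Qed.

Lemma simple_child_path x p :
    path (adj E) x p -> uniq (x :: p) -> x = ord0 \/ f x \notin p ->
  path is_child x p.
Proof.
elim: p x => //= y p IHp x /andP[Exy Ep] /andP[xp Uyp] x_start.
have cxy : is_child x y.
  move: Exy; rewrite adj_parent_graph => /orP[//|/andP[x0 /eqP eq_y]].
  by case: x_start x0 => [->|]; rewrite ?eqxx // -eq_y mem_head.
rewrite cxy IHp //; right; case/andP: cxy => _ /eqP <-.
by move: xp; rewrite inE negb_or => /andP[].
Qed.

Lemma parent_parent_graph u j : parent E u j = is_child u j.
Proof.
apply/andP/idP => [[Euj /on_root_pathP[p /and3P[Ep Up /eqP lastp] up]]|cuj].
  have cp := simple_child_path Ep Up (or_introl erefl).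
  move: Euj; rewrite adj_parent_graph => /orP[//|/is_child_depth].
  by rewrite ltnNge -lastp child_path_last.
rewrite adj_parent_graph cuj; split=> //; apply/on_root_pathP.
have [p Epj cp] := child_path_exists j; exists p => //.
have /and3P[_ _ /eqP lastp] := Epj; case/andP: cuj => j0 /eqP->.
case/lastP: p => [|p y] in cp lastp {Epj} *.
  by rewrite -lastp eqxx in j0.
move: lastp cp; rewrite last_rcons rcons_path => -> /andP[_ /andP[_ /eqP <-]].
by rewrite -rcons_cons mem_rcons inE mem_last orbT.
Qed.

Lemma is_graph_parent_graph : is_graph E.
Proof.
apply/'forall_implyP => e /imsetP[j]; rewrite inE => j0 ->.
by rewrite cards2 (_ : j != f j) //; apply: contraTneq (depth_f j0) => <-;
  rewrite ltnn.
Qed.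

Lemma connected_parent_graph : connected E.
Proof.
have con0 j : connect (adj E) ord0 j.
  have [p /and3P[Ep _ /eqP <-] _] := child_path_exists j.
  by apply/connectP; exists p.
apply/'forall_forallP => u v; apply: connect_trans (con0 v).
by rewrite (sym_connect_sym (adj_sym E)).
Qed.

(* Both neighbours of the deepest vertex of a cycle are its parent. *)
Lemma acyclic_parent_graph : acyclic E.
Proof.
apply/acyclicP => c c_gt2 /andP[cE Uc].
have [x0 x0c] : exists x, x \in c.
  by case: c c_gt2 {cE Uc} => // x c; exists x; rewrite mem_head.
have [x xc max_x] := arg_maxnP depth x0c.
have parent_x w : w \in c -> adj E x w -> w = f x.
  move=> /max_x /= le_wx; rewrite adj_parent_graph.
  by case/orP=> [/is_child_depth|/andP[_ /eqP//]]; rewrite ltnNge le_wx.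
have [i s eq_c] := rot_to xc.
move: cE Uc c_gt2; rewrite -(rot_cycle i) -(rot_uniq i) -(size_rot i).
have mem_c w : (w \in c) = (w \in rot i c) by rewrite mem_rot.
rewrite eq_c in mem_c *; case: s => [|y s] // in mem_c {eq_c} *.
case/lastP: s => [|s z] // in mem_c *.
rewrite /= rcons_path last_rcons => /and3P[Exy _ Ezx] /and3P[_ + _] _.
have -> : y = f x by apply: parent_x; rewrite // mem_c !inE eqxx orbT.
have -> : z = f x.
  by apply: parent_x; rewrite 1?adj_sym // mem_c !inE mem_rcons mem_head !orbT.
by rewrite mem_rcons mem_head.
Qed.

Lemma parent_graph_tree : is_tree E.
Proof.
by rewrite /is_tree is_graph_parent_graph connected_parent_graph
  acyclic_parent_graph.
Qed.

End ParentGraph.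

Lemma card_descents E : #|descents E| = \sum_i #|left_children E i|.
Proof.
rewrite -sum1dep_card big_mkcond /=.
rewrite -(pair_bigA _ (fun i j => if (j < i) && parent E i j then 1 else 0)) /=.
apply: eq_bigr => i _; rewrite -sum1dep_card [RHS]big_mkcond.
by apply: eq_bigr => j _; rewrite andbC.
Qed.

Lemma left_children_root E : left_children E ord0 = set0.
Proof. by apply/setP => j; rewrite !inE ltn0 andbF. Qed.

Lemma odd_tree_left_children E :
  odd_tree E -> exists2 v, v != ord0 & odd #|left_children E v|.
Proof.
rewrite /odd_tree card_descents => odd_sum.
have /existsP[v odd_v] : [exists v, odd #|left_children E v|].
  apply: contraLR odd_sum; rewrite negb_exists => /forallP even_E.
  by elim/big_ind: _ => // x y; rewrite oddD => /negPf-> /negPf->.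
exists v => //; apply: contraTneq odd_v => ->.
by rewrite left_children_root cards0.
Qed.

Lemma proper_noncrossing_treeE E :
  proper_noncrossing_tree E =
    noncrossing_tree E &&
    [forall v, (v != ord0) ==>
       ~~ odd #|left_children E v| && (right_children E v == set0)].
Proof.
rewrite /proper_noncrossing_tree /proper_vertex.
case oddE: (odd_tree E) => //; congr (_ && _).
have [v v0 odd_v] := odd_tree_left_children oddE.
transitivity false; last symmetry; apply/forallP => /(_ v); rewrite v0 /=.
  by case/andP=> _ /eqP left0; rewrite left0 cards0 in odd_v.
by rewrite odd_v.
Qed.

End RootedTrees.

(** * Proper noncrossing trees as forests *)

Section RootLast.

Variable n : nat.
Implicit Types (E : {set {set 'I_n.+1}}) (Q : nat -> nat) (v i j : 'I_n.+1).

(* The position of a vertex once the root is moved from the first to the last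
   place. *)
Definition rank i : nat := if i == ord0 then n.+1 else i.

Lemma neq_root i : (i != ord0) = (0 < i).
Proof. by rewrite -(inj_eq val_inj) lt0n. Qed.

Lemma rank_root : rank ord0 = n.+1.
Proof. by rewrite /rank eqxx. Qed.

Lemma rank_nonroot i : i != ord0 -> rank i = i.
Proof. by rewrite /rank => /negPf->. Qed.

Lemma rank_le i : rank i <= n.+1.
Proof. by rewrite /rank; case: ifP => // _; apply: ltnW. Qed.

Lemma rankK : cancel rank inZp.
Proof.
move=> i; rewrite /rank; case: eqVneq => [->|_]; last exact: valZpK.
by apply: val_inj; rewrite /= modnn.
Qed.

Lemma rank_inZp k : 0 < k <= n.+1 -> rank (inZp k) = k.
Proof.
case/andP=> k0; rewrite leq_eqVlt /rank -(inj_eq val_inj) /=.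
case/predU1P=> [->|lt_k]; first by rewrite modnn.
by rewrite modn_small // eqn0Ngt k0.
Qed.

Definition ascending Q : Prop := forall k, 0 < k < n.+1 -> k < Q k <= n.+1.

Lemma postorder_ascending Q : postorder 1 n.+1 n.+1 Q -> ascending Q.
Proof.
case=> gtQ boundQ _ k k_in.
by have := gtQ k k_in; have := boundQ k k_in; lia.
Qed.

Definition ascending_tree Q : {set {set 'I_n.+1}} :=
  parent_graph (fun j : 'I_n.+1 => inZp (Q j)).

Lemma no_right_children_ascending_tree E :
    is_tree E -> (forall v, v != ord0 -> right_children E v = set0) ->
  exists2 Q, ascending Q & ascending_tree Q = E.
Proof.
move=> /tree_parent_graph[f eq_E parent_f] no_right.
exists (fun k => rank (f (inZp k))) => [k k_in|].
  rewrite rank_le andbT; case/andP: k_in => k0 lt_k.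
  pose j := Ordinal lt_k; rewrite -[k]/(val j) valZpK.
  have j0 : j != ord0 by rewrite neq_root.
  have /andP[/andP[neq_fj _] _] := parent_f j j0.
  have [->|fj0] := eqVneq (f j) ord0; first by rewrite rank_root ltn_ord.
  rewrite rank_nonroot // ltn_neqAle (inj_eq val_inj) eq_sym neq_fj leqNgt.
  have /setP/(_ j) := no_right _ fj0; rewrite !inE parent_f //=.
  by move=> ->.
rewrite -eq_E; apply: eq_parent_graph => j _; by rewrite valZpK rankK.
Qed.

Section AscendingTree.

Variable Q : nat -> nat.
Hypothesis ascQ : ascending Q.
Notation E := (ascending_tree Q).

Lemma rank_parent j : j != ord0 -> rank (inZp (Q j)) = Q j.
Proof.
rewrite neq_root => j0; apply: rank_inZp.
by have := ascQ (k := j); have := ltn_ord j; lia.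
Qed.

Lemma ltn_sub_rank_parent j :
  j != ord0 -> n.+1 - rank (inZp (Q j)) < n.+1 - rank j.
Proof.
move=> j0; rewrite rank_parent // rank_nonroot //.
by have := ascQ (k := j); have := ltn_ord j; rewrite neq_root in j0; lia.
Qed.

Lemma ascending_tree_is_tree : is_tree E.
Proof. exact: parent_graph_tree ltn_sub_rank_parent. Qed.

Lemma parent_ascending_tree i j :
  parent E i j = (j != ord0) && (rank i == Q j).
Proof.
rewrite (parent_parent_graph ltn_sub_rank_parent) /is_child.
have [j0|//] := boolP (j != ord0).
by rewrite -(can_eq rankK) rank_parent.
Qed.

Lemma adj_ascending_tree i j :
  i < j -> adj E i j = if i == ord0 then Q j == n.+1 else Q i == j.
Proof.
move=> lt_ij; have j0 : j != ord0 by rewrite neq_root; lia.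
rewrite (adj_parent_graph ltn_sub_rank_parent).
rewrite -!(parent_parent_graph ltn_sub_rank_parent) !parent_ascending_tree.
rewrite j0 (rank_nonroot j0) /=.
have [->|i0] := eqVneq i ord0; first by rewrite rank_root orbF eq_sym.
rewrite rank_nonroot // eq_sym [_ == Q i]eq_sym.
by have := ascQ (k := j); have := ltn_ord j; lia.
Qed.

Lemma left_children_ascending_tree v :
  v != ord0 -> left_children E v = [set j | (j != ord0) && (Q j == v)].
Proof.
move=> v0; apply/setP => j; rewrite !inE parent_ascending_tree rank_nonroot //.
rewrite neq_root eq_sym; have := ascQ (k := j); have := ltn_ord j; lia.
Qed.

Lemma right_children_ascending_tree v : v != ord0 -> right_children E v = set0.
Proof.
move=> v0; apply/setP => j; rewrite !inE parent_ascending_tree rank_nonroot //.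
rewrite neq_root; have := ascQ (k := j); have := ltn_ord j; lia.
Qed.

Lemma card_left_children_ascending_tree v :
  v != ord0 ->
  #|left_children E v| = count_mem (v : nat) [seq Q k | k <- index_iota 1 n.+1].
Proof.
move=> v0; rewrite left_children_ascending_tree // count_map.
rewrite -sum1_count big_add1 big_mkord.
by rewrite -sum1dep_card big_mkcond big_ord_recl /= add0n -big_mkcond.
Qed.

Lemma noncrossing_ascending_nested i j :
  noncrossing E -> 0 < i -> i < j -> j < Q i -> Q j <= Q i.
Proof.
move=> ncE i0 lt_ij lt_jQ; rewrite leqNgt; apply/negP => lt_Q.
have no_crossing (a b c d : 'I_n.+1) :
    a < b -> b < c -> c < d -> adj E a c -> adj E b d -> False.
  move=> ab bc cd ac bd.
  have /'forall_'forall_'forall_'forall_implyP/(_ a b c d) := ncE.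
  by rewrite ab bc cd ac bd => /(_ isT).
have [root_i root_j] : (i == ord0) = false /\ (j == ord0) = false.
  by split; apply/negbTE; rewrite neq_root; lia.
have ascj : j < Q j <= n.+1 by apply: ascQ; have := ltn_ord j; lia.
have lt_Qi : Q i < n.+1 by lia.
pose vQi := Ordinal lt_Qi.
have adj_i : adj E i vQi by rewrite adj_ascending_tree ?root_i //=; lia.
have [eq_Qj|neq_Qj] := eqVneq (Q j) n.+1.
  apply: (no_crossing ord0 i j vQi) => //.
  by rewrite adj_ascending_tree ?eqxx ?eq_Qj //; apply: ltn_trans lt_ij.
have lt_Qj : Q j < n.+1 by lia.
apply: (no_crossing i j vQi (Ordinal lt_Qj)) => //.
by rewrite adj_ascending_tree ?root_j //=; lia.
Qed.

Lemma noncrossing_ascending_tree : noncrossing E <-> postorder 1 n.+1 n.+1 Q.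
Proof.
split=> [ncE | [_ _ nestQ]].
  split=> [k /ascQ|k /ascQ|k l k0 /andP[lt_kl lt_l] lt_lQ]; [lia | lia | ].
  have lt_k := ltn_trans lt_kl lt_l.
  exact: (@noncrossing_ascending_nested (Ordinal lt_k) (Ordinal lt_l)).
apply/'forall_'forall_'forall_'forall_implyP => a b c d /and3P[ab bc cd].
rewrite !adj_ascending_tree; try lia.
have := ltn_ord d; have -> : (b == ord0) = false.
  by apply/negbTE; rewrite neq_root; lia.
have := nestQ b c; case: eqVneq => [_|]; first by lia.
by rewrite neq_root; have := nestQ a b; lia.
Qed.

End AscendingTree.

Lemma ascending_tree_inj Q Q' :
    ascending Q -> ascending Q' -> ascending_tree Q = ascending_tree Q' ->
  {in index_iota 1 n.+1, Q =1 Q'}.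
Proof.
move=> ascQ ascQ' eqE k; rewrite mem_index_iota => k_in.
have [_ lt_k] := andP k_in; pose j := Ordinal lt_k.
have j0 : j != ord0 by rewrite neq_root; case/andP: k_in.
have : parent (ascending_tree Q) (inZp (Q j)) j.
  by rewrite parent_ascending_tree // j0 rank_parent //=.
by rewrite eqE parent_ascending_tree // j0 rank_parent // => /eqP.
Qed.

Lemma proper_ascending_tree Q :
  ascending Q ->
  proper_noncrossing_tree (ascending_tree Q) =
    noncrossing (ascending_tree Q) &&
    all (fun w => ~~ odd (count_mem w [seq Q k | k <- index_iota 1 n.+1]))
      (index_iota 1 n.+1).
Proof.
move=> ascQ; rewrite proper_noncrossing_treeE /noncrossing_tree.
rewrite ascending_tree_is_tree //=; congr (_ && _).
apply/'forall_implyP/allP => [even_v k | even_k v v0].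
  rewrite mem_index_iota => /andP[k0 lt_k].
  have v0 : Ordinal lt_k != ord0 by rewrite neq_root.
  by have /andP[] := even_v _ v0; rewrite card_left_children_ascending_tree.
rewrite right_children_ascending_tree // eqxx andbT.
rewrite card_left_children_ascending_tree // even_k // mem_index_iota.
by rewrite -neq_root v0 ltn_ord.
Qed.

End RootLast.

Definition forest_tree (n : nat) (F : forest) : {set {set 'I_n.+1}} :=
  ascending_tree n (forest_parent F 1 n.+1).

Section ForestTree.

Variables (n : nat) (F : forest).
Hypothesis size_F : fsize F = n.

Lemma postorder_forest_tree : postorder 1 n.+1 n.+1 (forest_parent F 1 n.+1).
Proof. by rewrite -size_F; apply: postorder_forest_parent. Qed.

Lemma proper_forest_tree :
  proper_noncrossing_tree (forest_tree n F) = even_forest F.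
Proof.
have post := postorder_forest_tree; have asc := postorder_ascending post.
rewrite proper_ascending_tree // (@even_forestE F 1 n.+1) size_F //.
have -> : noncrossing (forest_tree n F) by apply/noncrossing_ascending_tree.
have := map_forest_parent F 1 n.+1; rewrite size_F => ->.
by rewrite /index_iota subn1.
Qed.

End ForestTree.

Lemma forest_tree_inj n F F' :
  fsize F = n -> fsize F' = n -> forest_tree n F = forest_tree n F' -> F = F'.
Proof.
move=> size_F size_F' eqE; apply: (@parents_inj F F' 1 n.+1).
  by rewrite size_F.
rewrite -map_forest_parent -[RHS]map_forest_parent size_F size_F'.
by apply/eq_in_map/ascending_tree_inj => //;
  apply/postorder_ascending/postorder_forest_tree.
Qed.

Lemma forest_tree_surj n (E : {set {set 'I_n.+1}}) :
    noncrossing_tree E -> (forall v, v != ord0 -> right_children E v = set0) ->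
  exists2 F, fsize F = n & forest_tree n F = E.
Proof.
case/andP=> treeE ncE /(no_right_children_ascending_tree treeE)[Q ascQ eqE].
have postQ : postorder 1 n.+1 n.+1 Q.
  by apply/noncrossing_ascending_tree; rewrite ?eqE.
have [|F eqF] := postorder_forest _ postQ; first by rewrite leqnn.
have size_F : fsize F = n.
  by rewrite -(size_parents F 1 n.+1) eqF size_map size_iota subn1.
exists F => //; rewrite -eqE; apply: eq_parent_graph => j.
rewrite neq_root => j0; congr (inZp _).
have : {in index_iota 1 n.+1, forest_parent F 1 n.+1 =1 Q}.
  by apply/eq_in_map; rewrite -eqF -map_forest_parent size_F.
by apply; rewrite mem_index_iota j0 ltn_ord.
Qed.

Section SymmetricTernary.

Variable n : nat.
Implicit Type t : sym_ternary n.

Definition nct_of_sym t : {set {set 'I_n.+1}} :=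
  forest_tree n (forest_of_sym t).

Lemma symmetric_sym_ternary t : symmetric_ternary t.
Proof. by case/andP: (valP t). Qed.

Lemma fsize_sym_ternary t : fsize (forest_of_sym t) = n.
Proof.
rewrite fsize_forest_of_sym ?symmetric_sym_ternary //.
by case/andP: (valP t) => _ /eqP.
Qed.

Lemma proper_nct_of_sym t : proper_noncrossing_tree (nct_of_sym t).
Proof.
by rewrite proper_forest_tree ?fsize_sym_ternary ?even_forest_of_sym.
Qed.

Lemma nct_of_sym_inj : injective nct_of_sym.
Proof.
move=> t t' eqE; apply: val_inj.
apply: (can_in_inj forest_of_symK); try exact: symmetric_sym_ternary.
by apply: (@forest_tree_inj n); rewrite ?fsize_sym_ternary.
Qed.

Lemma nct_of_sym_surj E :
  proper_noncrossing_tree E -> exists t, nct_of_sym t = E.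
Proof.
move=> proper_E; have := proper_E; rewrite proper_noncrossing_treeE.
case/andP=> ncE /'forall_implyP children_E.
have [v /children_E/andP[_ /eqP//]|F size_F eqE] := forest_tree_surj ncE.
have evF : even_forest F by rewrite -(proper_forest_tree size_F) eqE.
have sym_F : symmetric_ternary (sym_of_forest F) &&
    (internal (sym_of_forest F) == n).
  rewrite -fsize_forest_of_sym ?symmetric_sym_of_forest //.
  by rewrite sym_of_forestK // size_F eqxx.
by exists (SymTernary sym_F); rewrite /nct_of_sym /= sym_of_forestK.
Qed.

End SymmetricTernary.

Theorem theorem2p1 (n : nat) :
  (exists f : proper_nct n -> sym_ternary n, bijective f) /\
  #|{: proper_nct n}| = #|{: sym_ternary n}|.
Proof.
pose g (t : sym_ternary n) : proper_nct n :=
  Sub (nct_of_sym t) (proper_nct_of_sym t).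
have g_inj : injective g by move=> t t' /(congr1 val)/nct_of_sym_inj.
have g_surj E : exists t, g t == E.
  by have [t eqE] := nct_of_sym_surj (valP E); exists t; apply/eqP/val_inj.
pose f E := xchoose (g_surj E).
have fK : cancel f g by move=> E; apply/eqP/(xchooseP (g_surj E)).
have f_bij : bijective f by exists g => // t; apply: g_inj; rewrite fK.
by split; [exists f | apply: bij_eq_card f_bij].
Qed.
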